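(* There exists a constant $C>0$ such that the following holds. Let $n$ be a positive integer, let $x \in \mathbb{Z}^n$ be a vector with no zero coordinates, let $B \subseteq \{\pm 1\}^n$ be a set that corresponds to a linear subspace of $\mathbb{F}_2^n$ of dimension $0.51n$, and let $Y$ be uniformly distributed in $B$. Then $$\max_{k \in \mathbb{Z}} \Pr[\langle x, Y\rangle = k] \leq C \sqrt{\frac{\ln n}{n}}.$$
   Context: $\langle x,y\rangle=\sum_{j=1}^n x_jy_j$. The set $\{\pm 1\}^n$ is identified with the vector space $\mathbb{F}_2^n$ coordinate by coordinate, by associating $-1$ with $1\in\mathbb{F}_2$ and $1$ with $0 \in \mathbb{F}_2$; ''$B$ corresponds to a subspace'' means that the image of $B$ under this identification is a linear subspace of $\mathbb{F}_2^n$. *)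

(* Defs.v *)
From mathcomp Require Import all_boot all_order all_algebra finmap.

Set Implicit Arguments.
Unset Strict Implicit.
Unset Printing Implicit Defensive.

Import Order.TTheory GRing.Theory Num.Theory.
Local Open Scope ring_scope.
Local Open Scope fset_scope.

Definition inner (n : nat) (x y : 'rV[int]_n) : int :=
  \sum_(j < n) x 0 j * y 0 j.

Definition is_sign_vector (n : nat) (y : 'rV[int]_n) : Prop :=
  forall j : 'I_n, y 0 j = 1 \/ y 0 j = -1.

(* On sign vectors this is the bijection {1, -1}^n -> F_2^n with 1 |-> 0 and
   -1 |-> 1; its values elsewhere are junk. *)
Definition sign_to_F2 (n : nat) (y : 'rV[int]_n) : 'rV['F_2]_n :=
  map_mx (fun z : int => if z == -1 then 1 else 0) y.

Definition corresponds_to (n : nat) (B : {fset 'rV[int]_n})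
    (V : {vspace 'rV['F_2]_n}) : Prop :=
  [fset sign_to_F2 y | y in B] =i V.

(* Equals 0 when B is empty; a B that corresponds to a subspace never is. *)
Definition Pr_uniform (R : realFieldType) (T : choiceType) (B : {fset T})
    (E : pred T) : R :=
  #|` [fset y in B | E y]|%:R / #|` B|%:R.

(* Main.v *)
(* Identify B with the subspace V of F_2^n and let F(z) be the sum over v in V of
   exp(i sum_j th_j s(z_j + v_j)), where s(0) = 1 and s(1) = -1; the
   characteristic function of <x, Y> at t is F(0) / |V| for th = t x.

   Moment bound: by induction on the coordinates, for every m,
     |V| sum_z |F(z)|^(2m) <= |V|^(2m) 2^n prod_j (1 + eta_j),
     eta_j = ((1 + |cos (2 th_j)|) / 2)^m.
   If V is not constant at coordinate k, then V = V0 u (v1 + V0) with V0 constant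
   at k, F_V(z) = F_V0(z) + F_V0(z + v1), and flipping z_k rotates the two terms in
   opposite directions, so that they cannot be aligned both at z and at the
   flipped point unless |cos (2 th_k)| is close to 1.
   As |F| is constant on V, it follows that
     (|F(0)| / |V|)^(2m) <= 2^n / |V|^2 * prod_j (1 + eta_j),
   and 2^n / |V|^2 is exponentially small because dim V > n / 2.

   Fourier inversion modulo a large prime N writes Pr[<x, Y> = k] as an average of
   characteristic functions over th = 2 pi t x / N, t < N. Take m of order
   n / ln n. If sum_j eta_j <= n / 200, the term is at most 1 / sqrt n; since each
   eta_j has average O(1 / sqrt m) over t, Markov's inequality bounds the proportion
   of the remaining t by O(1 / sqrt m) = O(sqrt (ln n / n)). *)
Require Import Defs.
From mathcomp Require Import all_boot all_order all_algebra finmap.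
From mathcomp Require Import all_classical all_reals all_analysis.
From mathcomp Require Import finfield ring lra zify.

Set Implicit Arguments.
Unset Strict Implicit.
Unset Printing Implicit Defensive.

Import Order.TTheory GRing.Theory Num.Theory.
Import numFieldNormedType.Exports.
Local Open Scope ring_scope.

(** * Power inequalities and rotated sums of two complex numbers *)

Lemma exprn_mean_le (R : realFieldType) (a b : R) m : 0 <= a -> 0 <= b ->
  ((a + b) / 2) ^+ m <= (a ^+ m + b ^+ m) / 2.
Proof.
move=> a0 b0; elim: m => [|m IH]; first by rewrite !expr0; lra.
have h : 0 <= (a ^+ m - b ^+ m) * (a - b).
  case/orP: (le_total a b) => ab.
    by rewrite mulr_le0 // subr_le0 // lerXn2r.
  by rewrite mulr_ge0 // subr_ge0 // lerXn2r.
rewrite exprS; apply: (@le_trans _ _ ((a + b) / 2 * ((a ^+ m + b ^+ m) / 2))).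
  by apply: ler_wpM2l => //; lra.
by rewrite !exprS; nra.
Qed.

(** The larger of the two numbers is at most [2 * s]; the smaller is at most their mean, hence at
    most [2 * s] times [(1 + c) / 2]. *)
Lemma two_point_exprn (R : realFieldType) (A B s c : R) m :
  0 <= A -> 0 <= B -> A <= 2 * s -> B <= 2 * s -> A + B <= 2 * s * (1 + c) ->
  A ^+ m + B ^+ m <= (2 * s) ^+ m * (1 + ((1 + c) / 2) ^+ m).
Proof.
move=> A0 B0; wlog AB : A B A0 B0 / A <= B => [hw As Bs h|].
  case/orP: (le_total A B) => AB; first exact: hw.
  by rewrite addrC; apply: hw => //; rewrite addrC.
move=> As Bs h; rewrite mulrDr mulr1 addrC lerD //.
  by rewrite lerXn2r // nnegrE (le_trans B0).
rewrite -exprMn lerXn2r // ?nnegrE //; first by lra.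
by lra.
Qed.

(* The two squared norms are those of [u + v] and of
   [exp(-i beta) u + exp(i beta) v], for [u = u1 + i u2], [v = v1 + i v2],
   [c = cos beta], [d = sin beta]. *)
Lemma rotated_sums_bound (R : realDomainType) (u1 u2 v1 v2 c d : R) :
  c ^+ 2 + d ^+ 2 = 1 ->
  let U := u1 ^+ 2 + u2 ^+ 2 in let W := v1 ^+ 2 + v2 ^+ 2 in
  let A := (u1 + v1) ^+ 2 + (u2 + v2) ^+ 2 in
  let B := ((c * u1 + d * u2) + (c * v1 - d * v2)) ^+ 2 +
           ((c * u2 - d * u1) + (c * v2 + d * v1)) ^+ 2 in
  [/\ A <= 2 * (U + W), B <= 2 * (U + W) &
      A + B <= 2 * (U + W) * (1 + `|c|)].
Proof.
move=> cd U W A B.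
have AU : 2 * (U + W) - A = (u1 - v1) ^+ 2 + (u2 - v2) ^+ 2.
  by rewrite /A /U /W; ring.
have BU : 2 * (U + W) - B = (c * u1 + d * u2 - (c * v1 - d * v2)) ^+ 2 +
           (c * u2 - d * u1 - (c * v2 + d * v1)) ^+ 2.
  have -> : U = (c ^+ 2 + d ^+ 2) * U by rewrite cd mul1r.
  have -> : W = (c ^+ 2 + d ^+ 2) * W by rewrite cd mul1r.
  by rewrite /B /U /W; ring.
have A2 : A <= 2 * (U + W) by rewrite -subr_ge0 AU addr_ge0 // sqr_ge0.
have B2 : B <= 2 * (U + W) by rewrite -subr_ge0 BU addr_ge0 // sqr_ge0.
split=> //.
pose p := u1 * v1 + u2 * v2; pose q := u1 * v2 - u2 * v1.
(* With z = conj(u) v = p + i q, the cross terms of A and B are 2 Re z and 2 Re(exp(2 i beta) z);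
   they add up to 4 cos(beta) Re(exp(i beta) z). *)
have AB : A + B = 2 * (U + W) + 2 * (c * (2 * (c * p - d * q))).
  have -> : B = (c ^+ 2 + d ^+ 2) * (U + W) +
     2 * (c ^+ 2 * p - d ^+ 2 * p - 2 * c * d * q).
    by rewrite /B /U /W /p /q; ring.
  have -> : d ^+ 2 = 1 - c ^+ 2 by rewrite -cd; ring.
  by rewrite /A /U /W /p /q; ring.
have X : `|2 * (c * p - d * q)| <= U + W.
  rewrite ler_norml; apply/andP; split; rewrite -subr_ge0.
    have -> : 2 * (c * p - d * q) - - (U + W) =
      (u1 + (c * v1 - d * v2)) ^+ 2 + (u2 + (c * v2 + d * v1)) ^+ 2.
      have -> : W = (c ^+ 2 + d ^+ 2) * W by rewrite cd mul1r.
      by rewrite /U /W /p /q; ring.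
    by rewrite addr_ge0 // sqr_ge0.
  have -> : U + W - 2 * (c * p - d * q) =
    (u1 - (c * v1 - d * v2)) ^+ 2 + (u2 - (c * v2 + d * v1)) ^+ 2.
    have -> : W = (c ^+ 2 + d ^+ 2) * W by rewrite cd mul1r.
    by rewrite /U /W /p /q; ring.
  by rewrite addr_ge0 // sqr_ge0.
have -> : 2 * (U + W) * (1 + `|c|) = 2 * (U + W) + 2 * (`|c| * (U + W)) by ring.
rewrite AB lerD2l ler_pM2l //.
rewrite (le_trans (ler_norm _)) // normrM.
by rewrite ler_wpM2l.
Qed.

(** * Exponential sums over subgroups of F_2^n and their moments *)

Definition F2_sign {A : pzRingType} (b : 'F_2) : A := if b == 0 then 1 else -1.

Lemma F2_signD1 (A : pzRingType) b : F2_sign (b + 1) = - F2_sign b :> A.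
Proof. by rewrite /F2_sign; case: b => [[|[|]]] //= i; rewrite ?opprK. Qed.

Lemma intr_F2_sign (A : pzRingType) b : (F2_sign b)%:~R = F2_sign b :> A.
Proof. by rewrite /F2_sign; case: ifP. Qed.

Section ExponentialSums.
Variables (R : realType) (n : nat).
Implicit Types (V : {set 'rV['F_2]_n}) (z v : 'rV['F_2]_n) (th : 'I_n -> R).

Lemma F2_eq1 (b : 'F_2) : b != 0 -> b = 1.
Proof. by case: b => [[|[|]]] // i _; apply: val_inj. Qed.

Lemma F2_addvv (v : 'rV['F_2]_n) : v + v = 0.
Proof.
by apply/rowP=> j; rewrite !mxE; case: (v _ _) => [[|[|]]] // i; apply: val_inj.
Qed.

Lemma F2_addvK v : involutive (+%R v).
Proof. by move=> z; rewrite addrA F2_addvv add0r. Qed.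

(** Over F_2 this is the same as a linear subspace; plain sets suit the induction, which passes to
    the half of V vanishing at a coordinate. *)
Definition subgroup_of_F2 V :=
  0 \in V /\ forall v w, v \in V -> w \in V -> v + w \in V.

Definition phase th z : R := \sum_j th j * F2_sign (z 0 j).

Definition cos_sum th V z : R := \sum_(v in V) cos (phase th (z + v)).
Definition sin_sum th V z : R := \sum_(v in V) sin (phase th (z + v)).

(* Squared modulus of [\sum_(v in V) exp (i * phase th (z + v))]. *)
Definition expsum2 th V z : R := cos_sum th V z ^+ 2 + sin_sum th V z ^+ 2.

Lemma expsum2_ge0 th V z : 0 <= expsum2 th V z.
Proof. by rewrite addr_ge0 // sqr_ge0. Qed.

Lemma phase_flip th z k :
  phase th (z + delta_mx 0 k) = phase th z - 2 * th k * F2_sign (z 0 k).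
Proof.
rewrite /phase (bigD1 k) //= [in RHS](bigD1 k) //= !mxE !eqxx F2_signD1.
rewrite (eq_bigr (fun j => th j * F2_sign (z 0 j))); first by ring.
by move=> j /negbTE jk; rewrite !mxE eqxx jk addr0.
Qed.

(** Translation by [v1] exchanges the two halves of V. The codomain is general so that the lemma
    also counts V. *)
Lemma sum_half (M : nmodType) V v1 k (f : 'rV['F_2]_n -> M) :
  subgroup_of_F2 V -> v1 \in V -> v1 0 k != 0 ->
  \sum_(v in V) f v = \sum_(v in [set v in V | v 0 k == 0]) f v +
                      \sum_(v in [set v in V | v 0 k == 0]) f (v1 + v).
Proof.
move=> [V0 VD] v1V /F2_eq1 v1k; rewrite (bigID (fun v => v 0 k == 0)) /=.
congr (_ + _); first by apply: eq_bigl => v; rewrite inE.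
rewrite (reindex_inj (inv_inj (F2_addvK v1))) /=.
apply: eq_bigl => v; rewrite inE; congr (_ && _).
  apply/idP/idP=> [h|]; last exact: VD.
  by rewrite -(F2_addvK v1 v) VD.
by rewrite !mxE v1k; case: (v 0 k) => [[|[|]]].
Qed.

(** This is eta_k; for fixed [m] it is close to 1 only when 2 th_k is near a multiple of pi. *)
Definition off_cos th m k : R := ((1 + `|cos (2 * th k)|) / 2) ^+ m.

Lemma off_cos_ge0 th m k : 0 <= off_cos th m k.
Proof. by rewrite exprn_ge0 // divr_ge0 // addr_ge0. Qed.

(** Every phase in the sum changes by the same amount, so F(z) is multiplied by exp(-i b). *)
Lemma cos_sum_flip th V z k (b := 2 * th k * F2_sign (z 0 k)) :
  (forall v, v \in V -> v 0 k = 0) ->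
  cos_sum th V (z + delta_mx 0 k) =
    cos b * cos_sum th V z + sin b * sin_sum th V z /\
  sin_sum th V (z + delta_mx 0 k) =
    cos b * sin_sum th V z - sin b * cos_sum th V z.
Proof.
move=> Vk; have ph v : v \in V ->
    phase th (z + delta_mx 0 k + v) = phase th (z + v) - b.
  by move=> vV; rewrite addrAC phase_flip mxE (Vk v vV) addr0.
split; rewrite /cos_sum /sin_sum !mulr_sumr -?sumrB -?big_split /=;
  apply: eq_bigr => v vV; rewrite ph // ?cosB ?sinB; ring.
Qed.

Lemma sum_expsum2_pair th V0 V m k v1 z :
  (forall v, v \in V0 -> v 0 k = 0) -> v1 0 k != 0 ->
  (forall f : 'rV['F_2]_n -> R,
     \sum_(v in V) f v = \sum_(v in V0) f v + \sum_(v in V0) f (v1 + v)) ->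
  expsum2 th V z ^+ m + expsum2 th V (z + delta_mx 0 k) ^+ m <=
  4 ^+ m * (1 + off_cos th m k) *
    ((expsum2 th V0 z ^+ m + expsum2 th V0 (z + v1) ^+ m) / 2).
Proof.
move=> V0k /F2_eq1 v1k split_sum.
have csE y : cos_sum th V y = cos_sum th V0 y + cos_sum th V0 (y + v1).
  rewrite /cos_sum split_sum; congr (_ + _).
  by apply: eq_bigr => v _; rewrite addrA.
have snE y : sin_sum th V y = sin_sum th V0 y + sin_sum th V0 (y + v1).
  rewrite /sin_sum split_sum; congr (_ + _).
  by apply: eq_bigr => v _; rewrite addrA.
have [cu su] := cos_sum_flip th z V0k.
have [cv sv] := cos_sum_flip th (z + v1) V0k.
pose b := 2 * th k * F2_sign (z 0 k).
(* At z + v1 the sign at k is opposite, so the second term rotates the other way. *)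
have bE : 2 * th k * F2_sign ((z + v1) 0 k) = - b.
  by rewrite mxE v1k F2_signD1 mulrN.
rewrite bE cosN sinN in cv sv.
have absb : `|cos b| = `|cos (2 * th k)|.
  by rewrite /b /F2_sign; case: ifP; rewrite ?mulr1 // mulrN mulr1 cosN.
have [Ab Bb ABb] := rotated_sums_bound (cos_sum th V0 z) (sin_sum th V0 z)
  (cos_sum th V0 (z + v1)) (sin_sum th V0 (z + v1)) (cos2Dsin2 b).
rewrite absb in ABb.
have AE : expsum2 th V z = (cos_sum th V0 z + cos_sum th V0 (z + v1)) ^+ 2 +
   (sin_sum th V0 z + sin_sum th V0 (z + v1)) ^+ 2.
  by rewrite /expsum2 csE snE.
have BE : expsum2 th V (z + delta_mx 0 k) =
  ((cos b * cos_sum th V0 z + sin b * sin_sum th V0 z) +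
   (cos b * cos_sum th V0 (z + v1) - sin b * sin_sum th V0 (z + v1))) ^+ 2 +
  ((cos b * sin_sum th V0 z - sin b * cos_sum th V0 z) +
   (cos b * sin_sum th V0 (z + v1) + sin b * cos_sum th V0 (z + v1))) ^+ 2.
  rewrite /expsum2 csE snE (addrAC z _ v1) cu su cv sv; ring.
rewrite -AE -BE in Ab Bb ABb.
apply: le_trans (two_point_exprn m (expsum2_ge0 _ _ _) (expsum2_ge0 _ _ _) Ab Bb ABb) _.
rewrite -/(expsum2 th V0 z) -/(expsum2 th V0 (z + v1)) -/(off_cos th m k).
rewrite -mulrA [in leRHS]mulrCA [in leRHS]mulrC ler_wpM2r //.
  by rewrite addr_ge0 // off_cos_ge0.
set U := expsum2 th V0 z; set W := expsum2 th V0 (z + v1).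
(* The two-point bound gives (2 (U + W))^m; written with the mean of U and W, it yields 4^m and a
   power mean. *)
have -> : 2 * (U + W) = 4 * ((U + W) / 2) by field.
rewrite exprMn ler_wpM2l ?exprn_ge0 //.
by apply: exprn_mean_le; exact: expsum2_ge0.
Qed.

(** Induction on a list [s] of coordinates outside of which V vanishes. Halving V at k multiplies
    |V|^(2m) by 4^m, which is the loss in the pair bound; the factor |V| on the left absorbs its
    1/2. *)
Lemma sum_expsum2_le th m (s : seq 'I_n) V :
  subgroup_of_F2 V -> (forall v k, v \in V -> k \notin s -> v 0 k = 0) ->
  #|V|%:R * \sum_z expsum2 th V z ^+ m <=
  #|V|%:R ^+ (2 * m) * (2 ^+ n * \prod_(k <- s) (1 + off_cos th m k)).
Proof.
elim: s V => [|k s IH] V Vsub Voff.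
  have VE : V = [set 0].
    apply/setP => v; rewrite inE; apply/idP/eqP => [vV|->]; last by case: Vsub.
    by apply/rowP => j; rewrite mxE Voff.
  have e1 z : expsum2 th V z = 1.
    by rewrite /expsum2 /cos_sum /sin_sum VE !big_set1 cos2Dsin2.
  rewrite big_nil mulr1 (eq_bigr (fun=> 1)) => [|z _]; last by rewrite e1 expr1n.
  rewrite sumr_const card_mx card_Fp // VE cards1 mul1n.
  by rewrite expr1n !mul1r natrX.
rewrite big_cons.
have prod_ge0 : 0 <= \prod_(k <- s) (1 + off_cos th m k).
  by apply: prodr_ge0 => j _; rewrite addr_ge0 // off_cos_ge0.
case: (boolP [exists v in V, v 0 k != 0]); last first.
  (* V already vanishes at k: the factor 1 + eta_k >= 1 is given away. *)
  rewrite negb_exists_in => /forall_inP Vk.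
  apply: le_trans (IH V Vsub _) _.
    move=> v j vV js; have [->|jk] := eqVneq j k.
      by apply/eqP; have := Vk v vV; rewrite negbK.
    by apply: Voff; rewrite // inE negb_or jk.
  rewrite !ler_wpM2l ?exprn_ge0 //.
  by rewrite ler_peMl // lerDl off_cos_ge0.
case/exists_inP => v1 v1V v1k.
set V0 := [set v in V | v 0 k == 0].
have half M f := @sum_half M V v1 k f Vsub v1V v1k.
have V0k v : v \in V0 -> v 0 k = 0 by rewrite inE => /andP[_ /eqP].
have V0sub : subgroup_of_F2 V0.
  case: Vsub => V00 VD; split=> [|v w]; first by rewrite inE V00 mxE eqxx.
  rewrite !inE => /andP[vV /eqP v0] /andP[wV /eqP w0].
  by rewrite VD // mxE v0 w0 addr0 eqxx.
have cardV : #|V|%:R = 2 * #|V0|%:R :> R.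
  by rewrite -!sum1_card half -/V0 natrD; ring.
have {}IH : #|V0|%:R * \sum_z expsum2 th V0 z ^+ m <=
    #|V0|%:R ^+ (2 * m) * (2 ^+ n * \prod_(k <- s) (1 + off_cos th m k)).
  apply: IH => // v j vV0 js; have [->|jk] := eqVneq j k; first exact: V0k.
  by apply: Voff; [move: vV0; rewrite inE => /andP[] | rewrite inE negb_or jk].
have shift (w : 'rV['F_2]_n) (f : 'rV['F_2]_n -> R) :
    \sum_z f (z + w) = \sum_z f z.
  by rewrite [RHS](reindex_inj (addIr w)).
have key : \sum_z expsum2 th V z ^+ m <=
    4 ^+ m * (1 + off_cos th m k) / 2 * \sum_z expsum2 th V0 z ^+ m.
  (* Twice the sum over z is a sum over the pairs z, z + e_k. *)
  rewrite -(ler_pM2l (ltr0Sn R 1)) mulrDl mul1r.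
  rewrite -{2}(shift (delta_mx 0 k) (fun z => expsum2 th V z ^+ m)) -big_split.
  apply: (le_trans (ler_sum _ (fun z _ => sum_expsum2_pair th m z V0k v1k (half R)))).
  rewrite -mulr_sumr -mulr_suml big_split /=.
  rewrite (shift v1 (fun z => expsum2 th V0 z ^+ m)) le_eqVlt; apply/orP; left.
  by apply/eqP; field.
rewrite cardV.
apply: (@le_trans _ _ (4 ^+ m * (1 + off_cos th m k) *
   (#|V0|%:R * \sum_z expsum2 th V0 z ^+ m))).
  apply: le_trans (ler_wpM2l _ key) _; first by rewrite mulr_ge0.
  by rewrite le_eqVlt; apply/orP; left; apply/eqP; field.
apply: le_trans (ler_wpM2l _ IH) _.
  by rewrite mulr_ge0 ?exprn_ge0 // addr_ge0 // off_cos_ge0.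
rewrite exprMn !exprM.
have -> : 2 ^+ 2 = 4 :> R by ring.
by rewrite le_eqVlt; apply/orP; left; apply/eqP; ring.
Qed.

Lemma expsum2_shift th V z : subgroup_of_F2 V -> z \in V ->
  expsum2 th V z = expsum2 th V 0.
Proof.
move=> [_ VD] zV; rewrite /expsum2 /cos_sum /sin_sum.
have re (f : 'rV['F_2]_n -> R) : \sum_(v in V) f (0 + v) = \sum_(v in V) f (z + v).
  rewrite (reindex_inj (inv_inj (F2_addvK z))) /=.
  apply: eq_big => v; last by rewrite add0r.
  apply/idP/idP=> [h|]; last exact: VD.
  by rewrite -(F2_addvK z v) VD.
by rewrite -(re (fun v => cos (phase th v))) -(re (fun v => sin (phase th v))).
Qed.

(** Only the terms z in V of the moment sum are kept; these |V| equal terms supply the second factor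
    |V|. *)
Lemma expsum2_0_le th m V : subgroup_of_F2 V ->
  (expsum2 th V 0 / #|V|%:R ^+ 2) ^+ m <=
  2 ^+ n / #|V|%:R ^+ 2 * \prod_k (1 + off_cos th m k).
Proof.
move=> Vsub; have V_gt0 : 0 < #|V|%:R :> R.
  by rewrite ltr0n; apply/card_gt0P; exists 0; case: Vsub.
have off v k : v \in V -> k \notin index_enum 'I_n -> v 0 k = 0.
  by rewrite mem_index_enum.
have le_sum := sum_expsum2_le th m Vsub off.
have {le_sum} : #|V|%:R ^+ 2 * expsum2 th V 0 ^+ m <=
    #|V|%:R ^+ (2 * m) * (2 ^+ n * \prod_k (1 + off_cos th m k)).
  apply: le_trans le_sum; rewrite expr2 -mulrA ler_pM2l //.
  rewrite [leRHS](bigID (mem V)) /= -[leLHS]addr0 lerD //.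
    under eq_bigr => z zV do rewrite expsum2_shift //.
    by rewrite sumr_const mulr_natl.
  by apply: sumr_ge0 => z _; rewrite exprn_ge0 // expsum2_ge0.
rewrite expr_div_n -exprM => h.
rewrite ler_pdivrMr ?exprn_gt0 // -(ler_pM2l (exprn_gt0 2 V_gt0)).
apply: le_trans h _; rewrite le_eqVlt; apply/orP; left; apply/eqP.
by field; rewrite gt_eqF.
Qed.

End ExponentialSums.

(** * Cosine sums over residues modulo N *)

Section Trigonometry.
Variable R : realType.
Implicit Types (x y b : R) (N m : nat).

(** With y = x / 2, sin x = 2 sin y cos y; on [0, pi/4] the cosine is at least cos(pi/4), so sin y
    >= cos(pi/4) y by the mean value theorem, and cos(pi/4)^2 = 1/2. *)
Lemma sin_ge_half x : 0 <= x <= pi / 2 -> x / 2 <= sin x.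
Proof.
move=> /andP[x0 xpi]; have pi0 := pi_gt0 R.
have cosq : cos (pi / 4) ^+ 2 = 1 / 2 :> R.
  have := cos_mulr2n (pi / 4 : R).
  have -> : (pi / 4) *+ 2 = pi / 2 :> R by field.
  by rewrite cos_pihalf; lra.
have cosq0 : 0 <= cos (pi / 4 : R) by apply: cos_ge0_pihalf; lra.
have cos_ge y : 0 <= y <= pi / 4 -> cos (pi / 4) <= cos y.
  move=> /andP[y0 ypi]; rewrite leNgt ltr_cos -?leNgt ?in_itv //=; lra.
pose y := x / 2; have xE : x = y *+ 2 by rewrite /y; field.
have yb : 0 <= y <= pi / 4 by rewrite /y; lra.
have sinv : cos (pi / 4) * y <= sin y.
  have [y0|y0] : y = 0 \/ 0 < y.
  - by case/andP: yb; rewrite le_eqVlt => /orP[/eqP|] ; [left|right].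
  - by rewrite y0 sin0 mulr0.
  have [|z zI] := @MVT R sin cos _ _ y0 (fun z _ => is_derive_sin z).
    exact/continuous_subspaceT/continuous_sin.
  rewrite sin0 !subr0 => ->; rewrite ler_wpM2r ?(ltW y0) //.
  apply: cos_ge; move: zI; rewrite in_itv /=; lra.
rewrite xE sin_mulr2n.
have cv := cos_ge y yb; have y0 : 0 <= y by lra.
apply: (@le_trans _ _ ((cos (pi / 4) * (cos (pi / 4) * y)) *+ 2)).
  rewrite mulrA -expr2 cosq; lra.
by rewrite lerMn2r /= ler_pM // mulr_ge0.
Qed.

Lemma sum_cos_eq0 N D : (0 < D < N)%N ->
  \sum_(t < N) cos (2 * pi * t%:R * D%:R / N%:R) = 0 :> R.
Proof.
move=> /andP[D0 DN]; have N0 : (0 < N)%N by apply: leq_ltn_trans DN.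
have N0R : (0 : R) < N%:R by rewrite ltr0n.
pose b : R := pi * D%:R / N%:R.
have sb : sin b != 0.
  rewrite gt_eqF // sin_gt0_pi // /b divr_gt0 ?mulr_gt0 ?pi_gt0 ?ltr0n //=.
  by rewrite ltr_pdivrMr // ltr_pM2l ?pi_gt0 // ltr_nat.
apply: (mulfI sb); rewrite mulr0 mulr_sumr.
(* Multiplied by sin b, the sum telescopes; its ends differ by D full periods. *)
pose f t := sin (2 * b * t%:R - b) / 2.
rewrite (eq_bigr (fun t : 'I_N => f t.+1 - f t)); last first.
  move=> t _; rewrite /f -[t.+1%:R]natr1.
  have -> : 2 * pi * t%:R * D%:R / N%:R = 2 * b * t%:R :> R.
    by rewrite /b; field; rewrite gt_eqF.
  have -> : 2 * b * (t%:R + 1) - b = 2 * b * t%:R + b by ring.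
  by rewrite sinD sinB; field.
rewrite -(big_mkord xpredT (fun t => f t.+1 - f t)) telescope_sumr //.
rewrite /f mulr0 sub0r.
have -> : 2 * b * N%:R - b = - b + (pi *+ 2) *+ D.
  by rewrite /b -[(pi *+ 2) *+ D]mulr_natl -[pi *+ 2]mulr_natl; field; rewrite gt_eqF.
by rewrite periodicn ?subrr //; exact: sinD2pi.
Qed.

(** Orthogonality of characters; the bound on |D| turns congruence to 0 modulo N into equality. *)
Lemma sum_cos_delta N (D : int) : (`|D| < N)%N ->
  \sum_(t < N) cos (2 * pi * t%:R * D%:~R / N%:R) = N%:R * (D == 0)%:R :> R.
Proof.
move=> DN; case: eqVneq => [->|D0].
  rewrite (eq_bigr (fun=> 1)); first by rewrite sumr_const card_ord mulr1.
  by move=> t _; rewrite mulr0 mul0r cos0.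
have D0N : (0 < `|D| < N)%N by rewrite DN absz_gt0 D0.
rewrite mulr0; apply: etrans (sum_cos_eq0 D0N).
apply: eq_bigr => t _; rewrite -[LHS]cos_norm -[RHS]cos_norm; congr cos.
by rewrite !normrM natr_absz intr_norm normr_id.
Qed.

Lemma norm_cos_mod N a : (0 < N)%N ->
  `|cos (pi * (a %% N)%:R / N%:R)| = `|cos (pi * a%:R / N%:R)| :> R.
Proof.
move=> N0; have N0R : (0 : R) < N%:R by rewrite ltr0n.
rewrite [in RHS](divn_eq a N); elim: (a %/ N)%N => [|q IH]; first by rewrite mul0n add0n.
rewrite IH [in RHS]mulSn -[in RHS]addnA [in RHS]natrD mulrDr mulrDl.
rewrite mulfK ?gt_eqF // addrC.
by rewrite cosDpi normrN.
Qed.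

(** Multiplication by [c] permutes the residues, and |cos(pi a / N)| depends only on a modulo N. *)
Lemma sum_norm_cos_mul N c m : (0 < N)%N -> coprime N c ->
  \sum_(t < N) ((1 + `|cos (pi * (c * t)%:R / N%:R)|) / 2) ^+ m =
  \sum_(r < N) ((1 + `|cos (pi * r%:R / N%:R)|) / 2) ^+ m :> R.
Proof.
move=> N0 Nc; pose h (t : 'I_N) := Ordinal (ltn_pmod (c * t) N0).
have hI : injective h.
  suff H (t t' : 'I_N) : (t <= t')%N -> h t = h t' -> t = t'.
    move=> t t'; case/orP: (leq_total t t') => tt; first exact: H.
    by move/esym/(H _ _ tt).
  move=> tt' [] /eqP; rewrite eq_sym eqn_mod_dvd ?leq_mul2l ?tt' ?orbT //.
  rewrite -mulnBr Gauss_dvdr // => /dvdnP[q qE].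
  apply/val_inj/eqP; rewrite eqn_leq tt' /= -subn_eq0 qE muln_eq0.
  case: q qE => //= q qE; have := ltn_ord t'.
  have : (N <= t' - t)%N by rewrite qE mulSn leq_addr.
  by move=> h1 h2; have := leq_trans h1 (leq_subr t t'); rewrite leqNgt h2.
rewrite [RHS](reindex_inj hI) /=; apply: eq_bigr => t _.
by rewrite norm_cos_mod.
Qed.

(** The product (1 - x)^m (1 + m x) starts at 1 and does not increase with m. *)
Lemma onem_exprn_le m x : 0 <= x <= 1 -> (1 - x) ^+ m <= (1 + m%:R * x)^-1.
Proof.
move=> /andP[x0 x1]; have pos : 0 < 1 + m%:R * x by rewrite ltr_pwDl // mulr_ge0.
rewrite -[leRHS]mul1r ler_pdivlMr //.
elim: m {pos} => [|m IH]; first by rewrite expr0 mul0r addr0 mulr1.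
apply: le_trans IH; rewrite exprSr -mulrA ler_wpM2l ?exprn_ge0 ?subr_ge0 //.
rewrite -natr1 -subr_ge0.
have -> : 1 + m%:R * x - (1 - x) * (1 + (m%:R + 1) * x) = (m%:R + 1) * x ^+ 2.
  by ring.
by rewrite mulr_ge0 ?sqr_ge0 // natr1.
Qed.

Lemma norm_cos_exprn_le N m (r : nat) : (0 < N)%N -> (2 * r <= N)%N ->
  ((1 + `|cos (pi * r%:R / N%:R)|) / 2) ^+ m <=
  (1 + (r%:R * (Num.sqrt m%:R / (2 * N%:R))) ^+ 2)^-1 :> R.
Proof.
move=> N0 rN; have N0R : (0 : R) < N%:R by rewrite ltr0n.
have r2 : r%:R / N%:R <= 1 / 2 :> R.
  by rewrite ler_pdivrMr // mulrC mulrA mulr1 ler_pdivlMr // mulrC -natrM ler_nat.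
have r0 : 0 <= r%:R / N%:R :> R by rewrite divr_ge0.
set b := pi * r%:R / N%:R.
have bE : b = pi * (r%:R / N%:R) by rewrite /b mulrA.
have pi2 := pi_ge2 R.
have sb : r%:R / N%:R <= sin b.
  apply: (@le_trans _ _ (b / 2)); first by rewrite bE; nra.
  by apply: sin_ge_half; rewrite bE; nra.
have c1 := cos_max b; have c0 := normr_ge0 (cos b).
have cs : `|cos b| ^+ 2 + sin b ^+ 2 = 1 by rewrite real_normK ?num_real ?cos2Dsin2.
set x := (r%:R / N%:R) ^+ 2 / 4 : R.
(* |cos b| <= 1 - sin(b)^2 / 2, and sin b >= r / N. *)
have xle : (1 + `|cos b|) / 2 <= 1 - x.
  have : (r%:R / N%:R) ^+ 2 <= sin b ^+ 2 by rewrite lerXn2r // nnegrE (le_trans r0).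
  rewrite /x; nra.
have x0 : 0 <= x by rewrite divr_ge0 // sqr_ge0.
apply: (@le_trans _ _ ((1 - x) ^+ m)).
  by rewrite lerXn2r // nnegrE; lra.
have -> : (r%:R * (Num.sqrt m%:R / (2 * N%:R))) ^+ 2 = m%:R * x :> R.
  rewrite !exprMn sqr_sqrtr // /x; field; rewrite gt_eqF //.
by apply: onem_exprn_le; rewrite x0 /=; lra.
Qed.

Lemma sum_inv_sqr_le N (h : R) : 0 < h ->
  \sum_(r < N) (1 + (r%:R * h) ^+ 2)^-1 <= 1 + 2 / h.
Proof.
move=> h0; pose g r : R := (1 + r%:R * h)^-1.
have g0 r : 0 < 1 + r%:R * h by rewrite ltr_pwDl // mulr_ge0 // ltW.
(* Strengthened for induction: each term with r > 0 is at most (2 / h) (g (r - 1) - g r), because (1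
   + u)^2 <= 2 (1 + u^2). *)
suff : \sum_(r < N) (1 + (r%:R * h) ^+ 2)^-1 <= 1 + 2 / h * (1 - g N.-1).
  move/le_trans; apply; rewrite lerD2l ler_piMr //.
    by rewrite divr_ge0 // ltW.
  by rewrite gerBl invr_ge0 ltW.
elim: N => [|[|N] IH].
- by rewrite big_ord0 /g mul0r addr0 invr1 subrr mulr0 addr0.
- by rewrite big_ord1 /g !mul0r expr0n addr0 invr1 subrr mulr0 addr0.
rewrite big_ord_recr /=.
apply: le_trans (lerD IH (lexx _)) _.
rewrite /= -addrA lerD2l -lerBrDl -mulrBr.
have -> : 1 - g N.+1 - (1 - g N) = h * (g N * g N.+1).
  by rewrite /g -natr1; field; rewrite natr1 !gt_eqF.
have -> : 2 / h * (h * (g N * g N.+1)) = 2 * (g N * g N.+1).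
  by field; rewrite gt_eqF.
have a0 := g0 N; have b0 := g0 N.+1.
rewrite /g -invfM ler_pdivlMr ?mulr_gt0 // ler_pdivrMl; last first.
  by rewrite ltr_pwDl // sqr_ge0.
have bE : N.+1%:R * h = N%:R * h + h by rewrite -natr1 mulrDl mul1r.
move: a0 b0; rewrite bE; set w := N%:R * h => a0 b0.
have : 0 <= (w + h - 1) ^+ 2 by exact: sqr_ge0.
nra.
Qed.

Lemma sum_norm_cos_exprn_le N m : (0 < N)%N -> (0 < m)%N ->
  \sum_(r < N) ((1 + `|cos (pi * r%:R / N%:R)|) / 2) ^+ m <=
  4 + 8 * N%:R / Num.sqrt m%:R :> R.
Proof.
move=> N0 m0; have N0R : (0 : R) < N%:R by rewrite ltr0n.
have sm0 : (0 : R) < Num.sqrt m%:R by rewrite sqrtr_gt0 ltr0n.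
set h := Num.sqrt m%:R / (2 * N%:R) : R.
have h0 : 0 < h by rewrite divr_gt0 // mulr_gt0.
pose f (r : nat) : R := (1 + (r%:R * h) ^+ 2)^-1.
have f0 r : 0 <= f r by rewrite invr_ge0 addr_ge0 // sqr_ge0.
(* [(rev_ord r).+1] is N - r. One of r and N - r is at most N / 2, and |cos| takes the same value at
   both. *)
apply: (@le_trans _ _ (\sum_(r < N) (f r + f (rev_ord r).+1))).
  apply: ler_sum => r _; case: (leqP (2 * r) N) => rN.
    by apply: le_trans (norm_cos_exprn_le m N0 rN) _; rewrite lerDl.
  have rlt := ltn_ord r.
  have E : (rev_ord r).+1 = (N - r)%N by rewrite /= subnSK.
  have rN' : (2 * (N - r) <= N)%N.
    by rewrite mulnBr leq_subLR mul2n -addnn leq_add2r ltnW.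
  rewrite E; apply: le_trans (_ : f (N - r)%N <= _); last by rewrite lerDr.
  apply: le_trans (norm_cos_exprn_le m N0 rN').
  rewrite natrB ?(ltnW rlt) // mulrBr mulrBl mulfK ?gt_eqF //.
  by rewrite cosB cospi sinpi mul0r addr0 mulN1r normrN.
rewrite big_split /=.
rewrite [X in _ + X](reindex_inj rev_ord_inj) /=.
under [X in _ + X]eq_bigr => r _ do
  rewrite -[(N - (N - r.+1).+1)%N]/(val (rev_ord (rev_ord r))) rev_ordK.
have S1 : \sum_(r < N) f r <= 1 + 2 / h := sum_inv_sqr_le N h0.
have S2 : \sum_(r < N) f r.+1 <= 1 + 2 / h.
  have := sum_inv_sqr_le N.+1 h0; rewrite big_ord_recl /=.
  by apply: le_trans; rewrite lerDr -/(f 0).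
apply: le_trans (lerD S1 S2) _.
have -> : 2 / h = 4 * N%:R / Num.sqrt m%:R by rewrite /h; field; rewrite !gt_eqF.
lra.
Qed.

End Trigonometry.

(** * Fourier inversion and the bound on point probabilities *)

Section LittlewoodOfford.
Variables (R : realType) (n : nat).
Implicit Types (V : {set 'rV['F_2]_n}) (th : 'I_n -> R) (x : 'rV[int]_n).

Definition signed_sum x (v : 'rV['F_2]_n) : int := \sum_j x 0 j * F2_sign (v 0 j).

Lemma rotate_le_sqrt (a b y : R) :
  a * cos y + b * sin y <= Num.sqrt (a ^+ 2 + b ^+ 2).
Proof.
apply: le_trans (ler_norm _) _; rewrite -sqrtr_sqr ler_wsqrtr // -subr_ge0.
have -> : a ^+ 2 + b ^+ 2 - (a * cos y + b * sin y) ^+ 2 =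
    (a * sin y - b * cos y) ^+ 2.
  have -> : a ^+ 2 + b ^+ 2 = (cos y ^+ 2 + sin y ^+ 2) * (a ^+ 2 + b ^+ 2).
    by rewrite cos2Dsin2 mul1r.
  ring.
exact: sqr_ge0.
Qed.

Lemma sum_cos_phase_le th V y :
  \sum_(v in V) cos (phase th v - y) <= Num.sqrt (expsum2 th V 0).
Proof.
apply: le_trans (rotate_le_sqrt _ _ y); rewrite /cos_sum /sin_sum !mulr_suml.
rewrite -big_split /=; apply: ler_sum => v _.
by rewrite add0r cosB.
Qed.

(** Triangle inequality: |F|^2 is the sum of Re(conj(F) exp(i phase)), and each term is at most
    |F|. *)
Lemma sqrt_expsum2_le_card th V : Num.sqrt (expsum2 th V 0) <= #|V|%:R.
Proof.
set r := Num.sqrt _; have r0 : 0 <= r by exact: sqrtr_ge0.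
have [->|rn0] := eqVneq r 0; first by rewrite ler0n.
have rp : 0 < r by rewrite lt_def rn0.
rewrite -(ler_pM2r rp) -expr2 sqr_sqrtr ?expsum2_ge0 //.
have -> : expsum2 th V 0 = \sum_(v in V)
   (cos_sum th V 0 * cos (phase th v) + sin_sum th V 0 * sin (phase th v)).
  rewrite big_split -!mulr_sumr /expsum2 !expr2 /=.
  by congr (_ * _ + _ * _); apply: eq_bigr => v _; rewrite add0r.
rewrite mulr_natl -sumr_const; apply: ler_sum => v _.
exact: rotate_le_sqrt.
Qed.

Definition frequency x N t : 'I_n -> R :=
  fun j => 2 * pi * t%:R * (x 0 j)%:~R / N%:R.

Lemma phase_frequency x N t v :
  phase (frequency x N t) v = 2 * pi * t%:R * (signed_sum x v)%:~R / N%:R.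
Proof.
rewrite /phase /frequency /signed_sum rmorph_sum /= mulr_sumr mulr_suml.
by apply: eq_bigr => j _; rewrite rmorphM /= intr_F2_sign; ring.
Qed.

(** Orthogonality detects the event [signed_sum x v = k]; after exchanging the sums, each frequency
    contributes Re(F(0) exp(-i y)) <= |F(0)|. *)
Lemma card_level_le V x k N :
  (forall v, v \in V -> (`|signed_sum x v - k| < N)%N) ->
  N%:R * #|[set v in V | signed_sum x v == k]|%:R <=
  \sum_(t < N) Num.sqrt (expsum2 (frequency x N t) V 0).
Proof.
move=> VN.
have -> : N%:R * #|[set v in V | signed_sum x v == k]|%:R =
    \sum_(v in V) \sum_(t < N)
      cos (2 * pi * t%:R * (signed_sum x v - k)%:~R / N%:R) :> R.
  rewrite (eq_bigr (fun v => N%:R * (signed_sum x v == k)%:R)); last first.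
    by move=> v vV; rewrite sum_cos_delta ?VN // subr_eq0.
  rewrite -mulr_sumr -sum1_card natr_sum; congr (_ * _).
  rewrite (eq_bigl (fun v => (v \in V) && (signed_sum x v == k))); last first.
    by move=> v; rewrite inE.
  by rewrite big_mkcondr; apply: eq_bigr => v _; case: eqP.
rewrite exchange_big; apply: ler_sum => t _.
apply: le_trans (sum_cos_phase_le _ _ (2 * pi * t%:R * k%:~R / N%:R)).
apply: ler_sum => v _; rewrite phase_frequency le_eqVlt; apply/orP; left.
by apply/eqP; congr cos; rewrite rmorphB /=; ring.
Qed.

(** Here 2 th_j = pi (4 x_j t) / N, and 4 x_j is invertible modulo N; oddness of N handles the 4. *)
Lemma sum_off_cos_le x N m j : (0 < m)%N -> odd N -> coprime N `|x 0 j| ->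
  \sum_(t < N) off_cos (frequency x N t) m j <= 4 + 8 * N%:R / Num.sqrt m%:R.
Proof.
move=> m0 Nodd Nx; have N0 : (0 < N)%N by case: N Nodd {Nx}.
apply: le_trans (sum_norm_cos_exprn_le R N0 m0).
have co : coprime N (4 * `|x 0 j|).
  by rewrite coprimeMr Nx andbT (@coprimeXr 2 N 2) // coprimen2.
rewrite -(sum_norm_cos_mul R m N0 co) le_eqVlt; apply/orP; left; apply/eqP.
apply: eq_bigr => t _; rewrite /off_cos /frequency; congr (((1 + `|_|) / 2) ^+ m).
rewrite -[LHS]cos_norm -[RHS]cos_norm; congr cos.
rewrite !natrM natr_absz intr_norm !normrM normr_id !(ger0_norm (ler0n _ _)).
by rewrite normfV; ring.
Qed.

(** The last term is Markov's inequality applied pointwise: it is at least 1 whenever the sum of the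
    eta_j reaches n / 200, where the trivial bound is used. *)
Lemma sqrt_normalized_expsum2_le th V m : subgroup_of_F2 V ->
  (0 < n)%N -> (0 < m)%N ->
  2 ^+ n / #|V|%:R ^+ 2 <= expR (- (n%:R / 100)) :> R ->
  m%:R * ln n%:R <= n%:R / 200 :> R ->
  Num.sqrt (expsum2 th V 0) / #|V|%:R <=
  (Num.sqrt n%:R)^-1 + 200 / n%:R * \sum_j off_cos th m j.
Proof.
move=> Vsub n0 m0 Vbig mle.
have n0R : (0 : R) < n%:R by rewrite ltr0n.
have V_gt0 : 0 < #|V|%:R :> R.
  by rewrite ltr0n; apply/card_gt0P; exists 0; case: Vsub.
set S := \sum_j _.
have S0 : 0 <= S by apply: sumr_ge0 => j _; exact: off_cos_ge0.
have [Sbig|Ssmall] := leP (n%:R / 200) S.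
  apply: (@le_trans _ _ 1).
    by rewrite ler_pdivrMr // mul1r sqrt_expsum2_le_card.
  apply: ler_wpDl; first by rewrite invr_ge0 sqrtr_ge0.
  by rewrite mulrAC ler_pdivlMr // mul1r mulrC -ler_pdivrMr.
apply: ler_wpDr; first by rewrite mulr_ge0 // divr_ge0.
set Q := expsum2 th V 0 / #|V|%:R ^+ 2.
have Q0 : 0 <= Q by rewrite divr_ge0 ?expsum2_ge0 // sqr_ge0.
have -> : Num.sqrt (expsum2 th V 0) / #|V|%:R = Num.sqrt Q.
  by rewrite sqrtrM ?expsum2_ge0 // sqrtrV ?sqr_ge0 // sqrtr_sqr gtr0_norm.
rewrite -sqrtrV ?ler0n // ler_wsqrtr //.
rewrite -(ler_pXn2r m0) ?nnegrE ?invr_ge0 ?ler0n //.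
apply: le_trans (expsum2_0_le th m Vsub) _.
have prodle : \prod_j (1 + off_cos th m j) <= expR S.
  rewrite expR_sum; apply: ler_prod => j _; rewrite expR_ge1Dx andbT.
  by rewrite addr_ge0 // off_cos_ge0.
(* The product exp(-n / 200) is at most n^(-m) by the choice of m; taking m-th roots leaves 1 /
   n. *)
apply: (@le_trans _ _ (expR (- (n%:R / 100)) * expR (n%:R / 200))).
  apply: ler_pM.
  - by rewrite divr_ge0 ?exprn_ge0 ?sqr_ge0.
  - by apply: prodr_ge0 => j _; rewrite addr_ge0 // off_cos_ge0.
  - exact: Vbig.
  - by apply: le_trans prodle _; rewrite ler_expR ltW.
rewrite -expRD.
have -> : n%:R^-1 ^+ m = expR (- (m%:R * ln n%:R)) :> R.
  by rewrite expRN expRM_natl lnK ?posrE // exprVn.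
by rewrite ler_expR; lra.
Qed.

Lemma level_prob_le V x k m : subgroup_of_F2 V -> (forall j, x 0 j != 0) ->
  (0 < n)%N -> (0 < m <= n)%N ->
  2 ^+ n / #|V|%:R ^+ 2 <= expR (- (n%:R / 100)) :> R ->
  m%:R * ln n%:R <= n%:R / 200 :> R ->
  #|[set v in V | signed_sum x v == k]|%:R / #|V|%:R <=
  2401 / Num.sqrt m%:R :> R.
Proof.
move=> Vsub x0 n0 /andP[m0 mn] Vbig mle.
have V_gt0 : 0 < #|V|%:R :> R.
  by rewrite ltr0n; apply/card_gt0P; exists 0; case: Vsub.
(* A prime above M exceeds every |signed sum - k| (inversion), every |x_j| (coprimality), m (so sqrt
   m <= N) and 2 (oddness). *)
pose M := (\max_(v in V) `|signed_sum x v - k| + \max_j `|x 0%R j| + m + 2)%N.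
have [N MN Npr] := prime_above M.
have N0 : (0 < N)%N := prime_gt0 Npr.
have N0R : (0 : R) < N%:R by rewrite ltr0n.
have Nodd : odd N.
  have : (2 < N)%N by apply: leq_ltn_trans MN; rewrite /M leq_addl.
  by case/even_prime: Npr => [->|].
have Nx j : coprime N `|x 0 j|.
  rewrite prime_coprime //; apply/negP => /dvdn_leq; rewrite absz_gt0 x0 => /(_ isT).
  rewrite leqNgt => /negP; apply; apply: leq_ltn_trans MN.
  apply: leq_trans (leq_bigmax (F := fun j => absz (x 0 j)) j) _.
  by rewrite /M -!addnA addnCA leq_addr.
have VN v : v \in V -> (`|signed_sum x v - k| < N)%N.
  move=> vV; apply: leq_ltn_trans MN.
  apply: leq_trans (leq_bigmax_cond (F := fun v => `|signed_sum x v - k|%N) v vV) _.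
  by rewrite /M -!addnA leq_addr.
have n0R : (0 : R) < n%:R by rewrite ltr0n.
have m0R : (0 : R) < m%:R by rewrite ltr0n.
have sm0 : (0 : R) < Num.sqrt m%:R by rewrite sqrtr_gt0.
have mN : Num.sqrt m%:R <= N%:R :> R.
  apply: (@le_trans _ _ m%:R).
    rewrite -[leRHS]sqr_sqrtr // expr2 ler_peMr ?sqrtr_ge0 //.
    by rewrite -[leLHS]sqrtr1 ler_wsqrtr // ler1n.
  by rewrite ler_nat ltnW //; apply: leq_ltn_trans MN; rewrite /M addnAC leq_addl.
rewrite ler_pdivrMr // -(ler_pM2l N0R).
apply: le_trans (card_level_le VN) _.
have termle t : Num.sqrt (expsum2 (frequency x N t) V 0) <=
   ((Num.sqrt m%:R)^-1 + 200 / n%:R * \sum_j off_cos (frequency x N t) m j) * #|V|%:R.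
  rewrite -ler_pdivrMr //.
  apply: le_trans (sqrt_normalized_expsum2_le (frequency x N t) Vsub n0 m0 Vbig mle) _.
  by rewrite lerD2r lef_pV2 ?posrE ?sqrtr_gt0 // ler_wsqrtr // ler_nat.
apply: (@le_trans _ _ (\sum_(t < N) ((Num.sqrt m%:R)^-1 +
    200 / n%:R * \sum_j off_cos (frequency x N t) m j) * #|V|%:R)).
  by apply: ler_sum => t _; exact: termle.
rewrite -mulr_suml mulrA ler_pM2r // big_split /= sumr_const card_ord -mulr_sumr.
rewrite exchange_big /=.
(* As sqrt m <= N, 4 + 8 N / sqrt m <= 12 N / sqrt m; the final constant is 2401 = 1 + 200 * 12. *)
have sumle : \sum_j \sum_(t < N) off_cos (frequency x N t) m j <=
    n%:R * (12 * N%:R / Num.sqrt m%:R).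
  rewrite mulr_natl -[n in leRHS]card_ord -sumr_const; apply: ler_sum => j _.
  apply: le_trans (sum_off_cos_le m0 Nodd (Nx j)) _.
  have : 1 <= N%:R / Num.sqrt m%:R :> R by rewrite ler_pdivlMr // mul1r.
  by rewrite -!mulrA; lra.
have : 200 / n%:R * (\sum_j \sum_(t < N) off_cos (frequency x N t) m j) <=
  200 / n%:R * (n%:R * (12 * N%:R / Num.sqrt m%:R)).
  by apply: ler_wpM2l => //; rewrite divr_ge0 // ltW.
rewrite -mulr_natr mulrCA mulrA => h; apply: le_trans (lerD (lexx _) h) _.
by rewrite le_eqVlt; apply/orP; left; apply/eqP; field; rewrite !gt_eqF.
Qed.

End LittlewoodOfford.

(** * Transfer from sign vectors to F_2^n, and the choice of m *)

Lemma card_fset_eqi (T : finType) (A : {fset T}) (P : {pred T}) :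
  A =i P -> #|` A| = #|P|.
Proof.
move=> AP; rewrite cardE; apply/perm_size/uniq_perm; rewrite ?enum_uniq //.
by move=> v; rewrite mem_enum AP.
Qed.

Lemma F2_sign_sign_to_F2 n (y : 'rV[int]_n) j :
  is_sign_vector y -> F2_sign (sign_to_F2 y 0 j) = y 0 j.
Proof. by move=> /(_ j); rewrite !mxE => -[->|->]. Qed.

Lemma sign_to_F2_inj n (y z : 'rV[int]_n) :
  is_sign_vector y -> is_sign_vector z -> sign_to_F2 y = sign_to_F2 z -> y = z.
Proof.
move=> ys zs yz; apply/rowP => j.
by rewrite -(F2_sign_sign_to_F2 _ ys) yz F2_sign_sign_to_F2.
Qed.

Lemma inner_signed_sum n (x y : 'rV[int]_n) :
  is_sign_vector y -> inner x y = signed_sum x (sign_to_F2 y).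
Proof. by move=> ys; apply: eq_bigr => j _; rewrite F2_sign_sign_to_F2. Qed.

Lemma Pr_uniform_corresponds_to (R : realFieldType) n (B : {fset 'rV[int]_n})
    (V : {vspace 'rV['F_2]_n}) x k :
  (forall y : 'rV[int]_n, y \in B -> is_sign_vector y) ->
  corresponds_to B V ->
  Pr_uniform R B (fun y => inner x y == k) =
  #|[set v in [set v in V] | signed_sum x v == k]|%:R / #|[set v in V]|%:R.
Proof.
move=> Bsign BV; rewrite /Pr_uniform; congr (_%:R / _%:R).
  pose L := [fset y in B | inner x y == k]%fset.
  transitivity #|` [fset sign_to_F2 y | y in L]%fset|.
    rewrite [RHS]card_in_imfset // => y z.
    rewrite !inE => /andP[yB _] /andP[zB _]; apply: sign_to_F2_inj; exact: Bsign.
  apply: card_fset_eqi => v; rewrite !inE -BV.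
  apply/imfsetP/andP => [[y /=]|[/imfsetP[y /= yB ->] yk]].
    rewrite !inE => /andP[yB yk] ->; split; first exact: in_imfset.
    by rewrite -inner_signed_sum //; exact: Bsign.
  by exists y => //; rewrite !inE yB inner_signed_sum //; exact: Bsign.
transitivity #|` [fset sign_to_F2 y | y in B]%fset|.
  rewrite card_in_imfset // => y z yB zB; apply: sign_to_F2_inj; exact: Bsign.
by apply: card_fset_eqi => v; rewrite inE; exact: BV.
Qed.

Lemma subgroup_of_F2_vspace n (V : {vspace 'rV['F_2]_n}) :
  subgroup_of_F2 [set v in V].
Proof.
split=> [|v w]; first by rewrite inE mem0v.
by rewrite !inE; exact: rpredD.
Qed.

Lemma half_le_expRNhalf (R : realType) : 2^-1 <= expR (- (1 / 2)) :> R.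
Proof. by apply: le_trans (expR_ge1Dx _); lra. Qed.

Lemma natr_percent (R : realType) n d :
  d%:R = 51 / 100 * n%:R :> R -> (100 * d = 51 * n)%N.
Proof.
by move=> dn; apply/eqP; rewrite -(eqr_nat R) !natrM dn; apply/eqP; field.
Qed.

(** The excess e = 2 dim V - n equals n / 50, and 2^(-e) <= exp(-e / 2) = exp(-n / 100). *)
Lemma vspace_card_bound (R : realType) n (V : {vspace 'rV['F_2]_n}) :
  (\dim V)%:R = 51 / 100 * n%:R :> R ->
  2 ^+ n / #|[set v in V]|%:R ^+ 2 <= expR (- (n%:R / 100)) :> R.
Proof.
move=> /natr_percent dimN.
pose e := (2 * \dim V - n)%N.
have eE : (2 * \dim V = n + e)%N by rewrite /e; lia.
have nE : n%:R / 100 = 1 / 2 * e%:R :> R.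
  have -> : (n = 50 * e)%N by rewrite /e; lia.
  by rewrite natrM; field.
rewrite cardsE card_vspace card_Fp // natrX -exprM mulnC eE exprD.
rewrite invfM mulVKf ?expf_neq0 // nE -mulNr expRM_natr -exprVn.
by rewrite lerXn2r ?nnegrE ?invr_ge0 ?expR_ge0 ?half_le_expRNhalf.
Qed.

Theorem theorem1 (R : realType) :
  exists2 C : R, 0 < C &
    forall (n : nat) (x : 'rV[int]_n) (B : {fset 'rV[int]_n})
           (V : {vspace 'rV['F_2]_n}),
      (0 < n)%N ->
      (forall j : 'I_n, x 0 j != 0) ->
      (forall y : 'rV[int]_n, y \in B -> is_sign_vector y) ->
      corresponds_to B V ->
      (\dim V)%:R = 51 / 100 * n%:R :> R ->
      forall k : int,
        Pr_uniform R B (fun y => inner x y == k) <=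
          C * Num.sqrt (ln n%:R / n%:R).
Proof.
(* The factor 20 is sqrt 400, from 1 / m <= 2 / w = 400 r below. *)
exists (2401 * 20); first by apply: mulr_gt0; rewrite ltr0n.
move=> n x B V n0 x0 Bsign BV dimV k.
rewrite (Pr_uniform_corresponds_to R x k Bsign BV).
(* The dimension hypothesis forces 100 to divide n, so ln n > 0. *)
have n1 : (1 < n)%N by have := natr_percent dimV; lia.
have n0R : (0 : R) < n%:R by rewrite ltr0n.
have ln0 : 0 < ln n%:R :> R by rewrite ln_gt0 // ltr1n.
set r := ln n%:R / n%:R; have r0 : 0 < r by rewrite divr_gt0.
have sr0 : 0 <= Num.sqrt r by exact: sqrtr_ge0.
(* The largest real m with m ln n <= n / 200; its integer part is used. *)
set w := n%:R / (200 * ln n%:R) : R.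
have w0 : 0 < w by rewrite divr_gt0 ?mulr_gt0 ?ltr0n.
have rw : r = (200 * w)^-1 by rewrite /r /w; field; rewrite !gt_eqF.
(* If w < 1 no positive m is available, but then r > 1 / 200 and the claimed bound exceeds 1. *)
have [w1|w1] := ltP w 1.
  apply: (@le_trans _ _ 1).
    have V0 : 0 < #|[set v in V]|%:R :> R.
      by rewrite ltr0n; apply/card_gt0P; exists 0; rewrite inE mem0v.
    rewrite ler_pdivrMr // mul1r ler_nat subset_leq_card //.
    by apply/fintype.subsetP => v; rewrite inE => /andP[].
  have : 1 / 20 <= Num.sqrt r.
    rewrite -[leLHS]gtr0_norm // -sqrtr_sqr ler_wsqrtr // rw.
    have -> : (1 / 20) ^+ 2 = (400)^-1 :> R by field.
    have p : (0 : R) < 400 by rewrite ltr0n.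
    have q : 0 < 200 * w by apply: mulr_gt0; rewrite ?ltr0n.
    rewrite lef_pV2 ?posrE ?p ?q {p q} //.
    lra.
  lra.
pose m := Num.truncn w.
have /andP[mw wm] := truncn_itv (ltW w0).
have m0 : (0 < m)%N by rewrite truncn_gt0.
have m0R : (0 : R) < m%:R by rewrite ltr0n.
have lnn : m%:R * ln n%:R <= n%:R / 200 :> R.
  apply: (@le_trans _ _ (w * ln n%:R)); first by rewrite ler_pM2r.
  by rewrite le_eqVlt /w; apply/orP; left; apply/eqP; field; rewrite gt_eqF.
have mn : (m <= n)%N.
  have ln2 : 1 / 2 <= ln n%:R :> R.
    rewrite -[leLHS]expRK ler_ln ?posrE ?expR_gt0 //.
    apply: (@le_trans _ _ 2); last by rewrite ler_nat.
    have := half_le_expRNhalf R.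
    by rewrite expRN lef_pV2 ?posrE ?expR_gt0.
  rewrite -(ler_nat R); nra.
apply: le_trans (level_prob_le k (subgroup_of_F2_vspace V) x0 n0 _ _ lnn) _.
- by rewrite m0.
- exact: vspace_card_bound.
rewrite -mulrA ler_pM2l; last by rewrite ltr0n.
have sqrt400 : 20 = Num.sqrt (20 ^+ 2) :> R by rewrite sqrtr_sqr gtr0_norm.
rewrite -sqrtrV ?ler0n // sqrt400 -sqrtrM ?sqr_ge0 // ler_wsqrtr // rw.
(* w < m + 1 <= 2 m. *)
have wm2 : w <= 2 * m%:R.
  have : 1 <= m%:R :> R by rewrite ler1n.
  move: wm; rewrite -/m -natr1; lra.
have -> : 20 ^+ 2 * (200 * w)^-1 = (w / 2)^-1 by field; rewrite gt_eqF.
by rewrite lef_pV2 ?posrE ?divr_gt0 //; lra.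
Qed.
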